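(* £ is classic, i.e.: (i) every sentence provable in classical first-order logic (in the language of £) is a thesis of £, and some thesis of £ is not provable in classical logic; and (ii) for no sentence $A$ is it the case both that $\Vdash A$ and that classical logic proves $\neg A$.
   Context: The language of the librationist theory £: variables; primitive set constants $\mathcal T$ (truth set) and $\mathcal F$; atomic formulas $a\in b$; formulas $\downarrow AB$ (joint denial), $\forall vA$; terms $\{v\mid A\}$; name terms $\ulcorner X\urcorner$. $\neg A:=\downarrow AA$, other connectives and $\exists$ classical; $\mathcal TA$ abbreviates $\ulcorner A\urcorner\in\mathcal T$. Semantics: for each $n\in\omega$ and ordinal $\alpha$ a full set $\models^\alpha_n$ of formulas ($\downarrow AB$ in it iff neither $A$ nor $B$; $\forall vA$ in it iff all substitution instances $A^b_v$ are); $(\models^0_n)_n$ a fixed enumeration of full sets; for $\alpha>0$, $\mathcal TA\in\models^\alpha_n$ iff for some $\gamma<\alpha$, $A\in\models^\delta_n$ for all $\gamma\le\delta<\alpha$, and $a\in\{x\mid A\}\in\models^\alpha_n$ iff $\mathcal TA^a_x\in\models^\alpha_n$. $\models^\alpha B$ iff $B\in\models^\alpha_n$ for all $n$. $\mathrm{IN}^\alpha(A)$ iff $\models^\beta\mathcal TA$ for all $\beta\ge\alpha$; $\mathrm{IN}(A)$ iff $\exists\alpha\,\mathrm{IN}^\alpha(A)$; $\alpha$ stabilizes $A$ iff ($\mathrm{IN}(A)\Rightarrow\mathrm{IN}^\alpha(A)$) and ($\models^\alpha\mathcal TA\Rightarrow\mathrm{IN}(A)$); $\varpi$ is the least ordinal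 stabilizing every sentence. $\Vdash A$ ($A$ is a thesis of £) iff $\neg\mathcal T\neg A\in\models^\varpi_n$ for all $n$. A theory is progressive if its theses properly extend those of classical logic, moderate if none of its theses is the negation of a theorem of classical logic, and classic if it is progressive and moderate. *)

(* Defs.v *)
From Stdlib Require Import Arith Lia Wellfounded.
From Stdlib Require Import Classical FunctionalExtensionality PropExtensionality.

(* Variables are de Bruijn indices: [Abs A] is {v | A} and [All A] is ∀v A, with
   v the index 0 of A.  Names may be formed of formulas and of terms, and the
   free variables of an expression are free in its name, so that one can
   quantify into 𝒯A. *)
Inductive term : Set :=
| Var (i : nat)
| Tset
| Fset
| Abs (A : formula)
| NameF (A : formula)
| NameT (t : term)
with formula : Set :=
| In (a b : term)
| Nor (A B : formula)
| All (A : formula).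

Definition Neg (A : formula) : formula := Nor A A.
Definition Or (A B : formula) : formula := Neg (Nor A B).
Definition Imp (A B : formula) : formula := Or (Neg A) B.
Definition Tr (A : formula) : formula := In (NameF A) Tset.

Definition up_ren (r : nat -> nat) (i : nat) : nat :=
  match i with 0 => 0 | S j => S (r j) end.

Fixpoint ren_term (r : nat -> nat) (t : term) : term :=
  match t with
  | Var i => Var (r i)
  | Tset => Tset
  | Fset => Fset
  | Abs A => Abs (ren_form (up_ren r) A)
  | NameF A => NameF (ren_form r A)
  | NameT u => NameT (ren_term r u)
  end
with ren_form (r : nat -> nat) (A : formula) : formula :=
  match A with
  | In a b => In (ren_term r a) (ren_term r b)
  | Nor B C => Nor (ren_form r B) (ren_form r C)
  | All B => All (ren_form (up_ren r) B)
  end.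

Definition up (s : nat -> term) (i : nat) : term :=
  match i with 0 => Var 0 | S j => ren_term S (s j) end.

Fixpoint subst_term (s : nat -> term) (t : term) : term :=
  match t with
  | Var i => s i
  | Tset => Tset
  | Fset => Fset
  | Abs A => Abs (subst_form (up s) A)
  | NameF A => NameF (subst_form s A)
  | NameT u => NameT (subst_term s u)
  end
with subst_form (s : nat -> term) (A : formula) : formula :=
  match A with
  | In a b => In (subst_term s a) (subst_term s b)
  | Nor B C => Nor (subst_form s B) (subst_form s C)
  | All B => All (subst_form (up s) B)
  end.

(* [inst A b] is A^b_v, v being the index 0 of A. *)
Definition inst (A : formula) (b : term) : formula :=
  subst_form (fun i => match i with 0 => b | S j => Var j end) A.

(* All free variables are below [k]. *)
Fixpoint bounded_term (k : nat) (t : term) : Prop :=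
  match t with
  | Var i => i < k
  | Tset => True
  | Fset => True
  | Abs A => bounded_form (S k) A
  | NameF A => bounded_form k A
  | NameT u => bounded_term k u
  end
with bounded_form (k : nat) (A : formula) : Prop :=
  match A with
  | In a b => bounded_term k a /\ bounded_term k b
  | Nor B C => bounded_form k B /\ bounded_form k C
  | All B => bounded_form (S k) B
  end.

Definition sentence (A : formula) : Prop := bounded_form 0 A.

Definition tautology (A : formula) : Prop :=
  forall v : formula -> bool,
    (forall B C, v (Nor B C) = negb (orb (v B) (v C))) -> v A = true.

Inductive provable : formula -> Prop :=
| prov_taut A : tautology A -> provable A
| prov_inst A b : provable (Imp (All A) (inst A b))
| prov_dist A B : provable (Imp (All (Imp A B)) (Imp (All A) (All B)))
| prov_vac A : provable (Imp A (All (ren_form S A)))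
| prov_mp A B : provable (Imp A B) -> provable A -> provable B
| prov_gen A : provable A -> provable (All A).

(* [osup I f] is the least ordinal strictly above all the [f i].  Distinct
   trees may denote the same ordinal; equality of ordinals is [ole] both ways. *)
Inductive ord : Type := osup (I : Type) (f : I -> ord).

Fixpoint ole (a b : ord) : Prop :=
  match a, b with osup K f, osup J g => forall i, exists j, ole (f i) (g j) end.

Definition olt (a b : ord) : Prop :=
  match b with osup J g => exists j, ole a (g j) end.

Definition ozero : ord := osup Empty_set (fun e => match e with end).

Definition full (X : formula -> Prop) : Prop :=
  (forall A B, X (Nor A B) <-> ~ X A /\ ~ X B) /\
  (forall A, X (All A) <-> forall b, X (inst A b)).

Definition family : Type := ord -> nat -> formula -> Prop.

(* [M a n A] is A ∈ ⊨^a_n.  The initial enumeration is [M ozero]; the atomic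
   formulas for which no clause is laid down are left unconstrained. *)
Record libra_semantics (M : family) : Prop := {
  sem_ext : forall a b n A, ole a b -> ole b a -> M a n A -> M b n A;
  sem_full : forall a n, full (M a n);
  sem_truth : forall a n A, olt ozero a ->
    (M a n (Tr A) <->
     exists c, olt c a /\ forall d, ole c d -> olt d a -> M d n A);
  sem_abs : forall a n x A, olt ozero a ->
    (M a n (In x (Abs A)) <-> M a n (Tr (inst A x)))
}.

Definition holds (M : family) (a : ord) (A : formula) : Prop := forall n, M a n A.

Definition IN_from (M : family) (a : ord) (A : formula) : Prop :=
  forall b, ole a b -> holds M b (Tr A).

Definition IN (M : family) (A : formula) : Prop := exists a, IN_from M a A.

Definition stabilizes (M : family) (a : ord) (A : formula) : Prop :=
  (IN M A -> IN_from M a A) /\ (holds M a (Tr A) -> IN M A).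

Definition stabilizes_all (M : family) (a : ord) : Prop :=
  forall A, sentence A -> stabilizes M a A.

Definition is_varpi (M : family) (w : ord) : Prop :=
  stabilizes_all M w /\ forall a, stabilizes_all M a -> ole w a.

Definition thesis (M : family) (A : formula) : Prop :=
  exists w, is_varpi M w /\ holds M w (Neg (Tr (Neg A))).

Definition progressive (Th : formula -> Prop) : Prop :=
  (forall A, sentence A -> provable A -> Th A) /\
  (exists A, sentence A /\ Th A /\ ~ provable A).

Definition moderate (Th : formula -> Prop) : Prop :=
  forall A, sentence A -> ~ (Th A /\ provable (Neg A)).

Definition classic_theory (Th : formula -> Prop) : Prop :=
  progressive Th /\ moderate Th.

Lemma ole_refl a : ole a a.
Proof. induction a as [I f IH]; simpl; intro i; exists i; apply IH. Qed.

Lemma ole_trans a : forall b c, ole a b -> ole b c -> ole a c.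
Proof.
  induction a as [I f IH]; intros [J g] [K h] H1 H2 i; simpl in *.
  destruct (H1 i) as [j Hj]; destruct (H2 j) as [k Hk].
  exists k; exact (IH i _ _ Hj Hk).
Qed.

Lemma olt_ole_trans a b c : olt a b -> ole b c -> olt a c.
Proof.
  destruct b as [J g], c as [K h]; simpl; intros [j Hj] H.
  destruct (H j) as [k Hk]; exists k; exact (ole_trans _ _ _ Hj Hk).
Qed.

Lemma olt_wf : well_founded olt.
Proof.
  assert (H : forall a b, ole b a -> Acc olt b).
  { induction a as [I f IH]; intros [J g] Hb; constructor; intros c [j Hj].
    destruct (Hb j) as [i Hi]; apply (IH i); exact (ole_trans _ _ _ Hj Hi). }
  intro a; exact (H a a (ole_refl a)).
Qed.

Fixpoint depth (A : formula) : nat :=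
  match A with
  | In _ _ => 0
  | Nor B C => S (max (depth B) (depth C))
  | All B => S (depth B)
  end.

Lemma depth_subst A : forall s, depth (subst_form s A) = depth A.
Proof.
  revert A; fix IH 1; intros [a b|B C|B] s; simpl;
    [reflexivity | rewrite !IH; reflexivity | rewrite IH; reflexivity].
Qed.

Fixpoint eval (v : term -> term -> Prop) (k : nat) (A : formula) : Prop :=
  match k, A with
  | _, In a b => v a b
  | 0, _ => False
  | S k, Nor B C => ~ eval v k B /\ ~ eval v k C
  | S k, All B => forall b, eval v k (inst B b)
  end.

Lemma eval_stable v k : forall l A, depth A <= k -> depth A <= l ->
  (eval v k A <-> eval v l A).
Proof.
  induction k as [|k IH]; intros l [a b|B C|B] Hk Hl; simpl in *; try lia;
    destruct l as [|l]; simpl; try lia; try tauto.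
  - rewrite (IH l B), (IH l C) by lia; tauto.
  - split; intros H b; specialize (H b); revert H;
      apply (IH l (inst B b)); unfold inst; rewrite depth_subst; lia.
Qed.

Lemma eval_full v : full (fun A => eval v (depth A) A).
Proof.
  split; [intros A B | intros A]; simpl.
  - rewrite (eval_stable v _ (depth A) A), (eval_stable v _ (depth B) B) by lia.
    tauto.
  - split; intros H b; specialize (H b); unfold inst in *;
      rewrite depth_subst in *; exact H.
Qed.

Definition atoms_at (X : formula -> Prop) (a b : term) : Prop :=
  match b, a with
  | Tset, NameF A => X A
  | Abs A, _ => X (inst A a)
  | _, _ => False
  end.

Definition revise (M0 : nat -> formula -> Prop) (a : ord)
    (rec : forall d, olt d a -> nat -> formula -> Prop) (n : nat) (A : formula)
    : Prop :=
  (~ olt ozero a /\ M0 n A) \/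
  (olt ozero a /\
   eval (atoms_at (fun B => exists c, olt c a /\
           forall d (h : olt d a), ole c d -> rec d h n B)) (depth A) A).

Theorem libra_semantics_exists (M0 : nat -> formula -> Prop) :
  (forall n, full (M0 n)) ->
  exists M : family, libra_semantics M /\ forall n A, M ozero n A <-> M0 n A.
Proof.
  intro H0.
  set (M := Fix olt_wf (fun _ => nat -> formula -> Prop) (revise M0)).
  set (ev a n := fun B => exists c, olt c a /\
        forall d (h : olt d a), ole c d -> M d n B).
  assert (E : forall a n A, M a n A <->
    (~ olt ozero a /\ M0 n A) \/
    (olt ozero a /\ eval (atoms_at (ev a n)) (depth A) A)).
  { intros a n A; unfold M at 1; rewrite Fix_eq; [reflexivity|].
    intros x f g Hfg; replace g with f; [reflexivity|].
    apply functional_extensionality_dep; intro d.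
    apply functional_extensionality_dep; intro h; apply Hfg. }
  assert (P : forall a n A, olt ozero a ->
    (M a n A <-> eval (atoms_at (ev a n)) (depth A) A))
    by (intros; rewrite E; tauto).
  assert (Z : forall a n A, ~ olt ozero a -> (M a n A <-> M0 n A))
    by (intros; rewrite E; tauto).
  exists M; split; [split|].
  - intros a b n A Hab Hba.
    assert (L : forall d, olt d a <-> olt d b)
      by (intro d; split; intro; eapply olt_ole_trans; eassumption).
    assert (Ev : ev a n = ev b n).
    { apply functional_extensionality; intro B.
      apply propositional_extensionality; unfold ev.
      split; intros [c [Hc H]]; exists c; split; try (apply L; exact Hc);
        intros d Hd; apply H; apply L; exact Hd. }
    rewrite (E a), (E b), Ev, (L ozero); tauto.
  - intros a n; destruct (classic (olt ozero a)) as [Ha|Ha].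
    + replace (M a n) with (fun A => eval (atoms_at (ev a n)) (depth A) A);
        [apply eval_full|].
      apply functional_extensionality; intro A.
      apply propositional_extensionality; symmetry; apply P; exact Ha.
    + replace (M a n) with (M0 n); [apply H0|].
      apply functional_extensionality; intro A.
      apply propositional_extensionality; symmetry; apply Z; exact Ha.
  - intros a n A Ha; rewrite (P a n (Tr A) Ha); simpl; unfold ev.
    split; intros [c [Hc H]]; exists c; split; auto.
  - intros a n x A Ha; rewrite !P by exact Ha; reflexivity.
  - intros n A; apply Z; intros [[]].
Qed.

(* Main.v *)
Require Import Defs.
From Stdlib Require Import Classical ClassicalEpsilon FunctionalExtensionality.

(** Call a formula settled when, from some stage on, it lies in every
    [⊨^a_n].  Settledness coincides with [IN], it is inherited from [A] by [𝒯A]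
    and by [¬𝒯¬A], and a settled sentence holds at every stabilizing stage [w],
    because [IN A] forces [𝒯A] to hold at [w + 1].  Full sets contain all
    classical theorems, so these are settled; this gives both moderateness and
    the inclusion of classical logic.  The thesis [𝒯⊤] is not a classical
    theorem, since it fails in a full set without atoms.

    A stabilizing stage is found by a closing-off argument: for every formula
    [A] which is not settled a single index [n] has [A] outside [⊨^d_n] for
    unboundedly many [d], so the limit of an [ω]-sequence of stages between
    which all those failures occur makes no unsettled [𝒯A] hold. *)

(* Names and abstracts put formulas inside terms, so each substitution law is proved for both sorts
   by one induction. *)
Scheme term_formula_ind := Induction for term Sort Prop
  with formula_term_ind := Induction for formula Sort Prop.
Combined Scheme expr_ind from term_formula_ind, formula_term_ind.

(** * Substitution *)

Definition scons (b : term) (s : nat -> term) (i : nat) : term :=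
  match i with 0 => b | S j => s j end.

Lemma subst_ren :
  (forall t r s, subst_term s (ren_term r t) = subst_term (fun i => s (r i)) t) /\
  (forall A r s, subst_form s (ren_form r A) = subst_form (fun i => s (r i)) A).
Proof.
  assert (U : forall r s, (fun i => up s (up_ren r i)) = up (fun i => s (r i)))
    by (intros r s; apply functional_extensionality; intros [|i]; reflexivity).
  apply expr_ind; simpl; intros; f_equal; auto;
    match goal with H : forall _, _ |- _ => now rewrite H, U end.
Qed.

Lemma ren_ren :
  (forall t r s, ren_term s (ren_term r t) = ren_term (fun i => s (r i)) t) /\
  (forall A r s, ren_form s (ren_form r A) = ren_form (fun i => s (r i)) A).
Proof.
  assert (U : forall r s,
    (fun i => up_ren s (up_ren r i)) = up_ren (fun i => s (r i)))
    by (intros r s; apply functional_extensionality; intros [|i]; reflexivity).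
  apply expr_ind; simpl; intros; f_equal; auto;
    match goal with H : forall _, _ |- _ => now rewrite H, U end.
Qed.

Lemma ren_subst :
  (forall t r s,
     ren_term r (subst_term s t) = subst_term (fun i => ren_term r (s i)) t) /\
  (forall A r s,
     ren_form r (subst_form s A) = subst_form (fun i => ren_term r (s i)) A).
Proof.
  assert (U : forall r s,
    (fun i => ren_term (up_ren r) (up s i)) = up (fun i => ren_term r (s i))).
  { intros r s; apply functional_extensionality; intros [|i]; simpl;
      [reflexivity | now rewrite !(proj1 ren_ren)]. }
  apply expr_ind; simpl; intros; f_equal; auto;
    match goal with H : forall _, _ |- _ => now rewrite H, U end.
Qed.

(** Crossing a binder renames the substituted terms by [S], so the binder case rests on [subst_ren]
    and [ren_subst]. *)
Lemma subst_subst :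
  (forall t r s,
     subst_term s (subst_term r t) = subst_term (fun i => subst_term s (r i)) t) /\
  (forall A r s,
     subst_form s (subst_form r A) = subst_form (fun i => subst_term s (r i)) A).
Proof.
  assert (U : forall r s,
    (fun i => subst_term (up s) (up r i)) = up (fun i => subst_term s (r i))).
  { intros r s; apply functional_extensionality; intros [|i]; simpl;
      [reflexivity | now rewrite (proj1 subst_ren), (proj1 ren_subst)]. }
  apply expr_ind; simpl; intros; f_equal; auto;
    match goal with H : forall _, _ |- _ => now rewrite H, U end.
Qed.

Lemma subst_var :
  (forall t, subst_term Var t = t) /\ (forall A, subst_form Var A = A).
Proof.
  assert (U : up Var = Var)
    by (apply functional_extensionality; intros [|i]; reflexivity).
  apply expr_ind; simpl; intros; f_equal; auto; rewrite U; auto.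
Qed.

Lemma inst_subst_up s A b :
  inst (subst_form (up s) A) b = subst_form (scons b s) A.
Proof.
  unfold inst; rewrite (proj2 subst_subst); f_equal.
  apply functional_extensionality; intros [|i]; simpl; [reflexivity|].
  rewrite (proj1 subst_ren); apply (proj1 subst_var).
Qed.

Lemma subst_inst s A b :
  subst_form s (inst A b) = inst (subst_form (up s) A) (subst_term s b).
Proof.
  rewrite inst_subst_up; unfold inst; rewrite (proj2 subst_subst); f_equal.
  apply functional_extensionality; intros [|i]; reflexivity.
Qed.

Lemma inst_subst_up_ren s A b :
  inst (subst_form (up s) (ren_form S A)) b = subst_form s A.
Proof. rewrite inst_subst_up, (proj2 subst_ren); reflexivity. Qed.

(** * Soundness of classical logic for full sets *)

Lemma full_neg X A : full X -> (X (Neg A) <-> ~ X A).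
Proof. intros [HN _]; unfold Neg; rewrite HN; tauto. Qed.

Lemma full_imp X A B : full X -> (X (Imp A B) <-> (X A -> X B)).
Proof.
  intros H; unfold Imp, Or; rewrite (full_neg _ _ H), (proj1 H), (full_neg _ _ H).
  tauto.
Qed.

Lemma full_tautology X A : full X -> tautology A -> X A.
Proof.
  intros [HN _] HA.
  (* A full set respects [Nor], so its characteristic function is an admissible valuation. *)
  pose (v := fun B => if excluded_middle_informative (X B) then true else false).
  assert (E : v A = true).
  { apply HA; intros B C; unfold v; specialize (HN B C).
    do 3 destruct excluded_middle_informative; simpl; tauto. }
  unfold v in E; destruct excluded_middle_informative; [assumption | discriminate].
Qed.

(** Substitution commutes with [Nor], so a valuation precomposed with it is again a valuation. *)
Lemma tautology_subst s A : tautology A -> tautology (subst_form s A).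
Proof.
  intros HA v Hv; apply (HA (fun B => v (subst_form s B))); intros B C; apply Hv.
Qed.

Lemma provable_full X A : full X -> provable A -> X A.
Proof.
  intros HX HA.
  (* Generalization needs closure under substitution. *)
  cut (forall s, X (subst_form s A)).
  { intros H; specialize (H Var); now rewrite (proj2 subst_var) in H. }
  induction HA as [A HA|A b|A B|A|A B _ IH1 _ IH2|A _ IH]; intros s.
  - apply (full_tautology _ _ HX), tautology_subst, HA.
  - change (X (Imp (All (subst_form (up s) A)) (subst_form s (inst A b)))).
    rewrite (full_imp _ _ _ HX), subst_inst, (proj2 HX); auto.
  - change (X (Imp (All (Imp (subst_form (up s) A) (subst_form (up s) B)))
                   (Imp (All (subst_form (up s) A)) (All (subst_form (up s) B))))).
    rewrite !(full_imp _ _ _ HX), !(proj2 HX); intros H1 H2 b.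
    apply (full_imp _ (inst (subst_form (up s) A) b) _ HX); [apply H1 | apply H2].
  - change (X (Imp (subst_form s A) (All (subst_form (up s) (ren_form S A))))).
    rewrite (full_imp _ _ _ HX), (proj2 HX); intros H b.
    now rewrite inst_subst_up_ren.
  - apply (full_imp _ (subst_form s A) _ HX); [apply IH1 | apply IH2].
  - simpl; rewrite (proj2 HX); intros b; rewrite inst_subst_up; apply IH.
Qed.

(** * Ordinals *)

Definition osucc (a : ord) : ord := osup unit (fun _ => a).

Lemma olt_osup I (f : I -> ord) i : olt (f i) (osup I f).
Proof. exists i; apply ole_refl. Qed.

Lemma olt_osucc a : olt a (osucc a).
Proof. exists tt; apply ole_refl. Qed.

Lemma osucc_ole a b : ole (osucc a) b <-> olt a b.
Proof.
  destruct b as [J g]; simpl; split; [intros H; exact (H tt) | intros H _; exact H].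
Qed.

Lemma ole_olt_trans a b c : ole a b -> olt b c -> olt a c.
Proof.
  destruct c as [K h]; intros H [k Hk]; exists k; exact (ole_trans _ _ _ H Hk).
Qed.

Lemma olt_ole b : forall a, olt a b -> ole a b.
Proof.
  induction b as [J g IH]; intros [I f] [j Hj] i; exists j.
  exact (IH j _ (olt_ole_trans _ _ _ (olt_osup _ f i) Hj)).
Qed.

Lemma ole_or_olt a : forall b, ole a b \/ olt b a.
Proof.
  induction a as [I f IH]; intros b.
  destruct (classic (exists i, ole b (f i))) as [H|H]; [right; exact H | left].
  destruct b as [J g]; simpl; intros i; apply NNPP; intros Hn.
  (* If no [g j] bounds [f i], induction puts every [g j] strictly below [f i], so [ole b (f i)],
     against [H]. *)
  apply H; exists i; specialize (IH i); destruct (f i) as [K h]; intros j.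
  destruct (IH (g j)) as [Hj|Hj]; [exfalso; eauto | exact Hj].
Qed.

Lemma ozero_ole a : ole ozero a.
Proof. destruct a; intros []. Qed.

(** The truth clause applies only above [ozero]; any strict predecessor certifies that. *)
Lemma olt_pos a b : olt a b -> olt ozero b.
Proof. exact (ole_olt_trans _ _ _ (ozero_ole a)). Qed.

Lemma ord_least (P : ord -> Prop) a :
  P a -> exists w, P w /\ forall b, P b -> ole w b.
Proof.
  induction a as [a IH] using (well_founded_ind olt_wf); intros Ha.
  destruct (classic (exists b, olt b a /\ P b)) as [[b [Hb HP]]|H]; [eauto|].
  exists a; split; [assumption|]; intros b Hb.
  destruct (ole_or_olt a b) as [Hab|Hba]; [assumption | exfalso; eauto].
Qed.

Lemma choice_fun {A B : Type} (R : A -> B -> Prop) :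
  (forall x, exists y, R x y) -> exists f, forall x, R x (f x).
Proof.
  intros H; exists (fun x => proj1_sig (constructive_indefinite_description _ (H x))).
  intros x; apply proj2_sig.
Qed.

(** * Settled formulas *)

Definition settled (M : family) (A : formula) : Prop :=
  exists a, forall d, ole a d -> holds M d A.

Lemma provable_settled M A : libra_semantics M -> provable A -> settled M A.
Proof.
  intros hM HA; exists ozero; intros d _ n.
  exact (provable_full _ _ (sem_full _ hM d n) HA).
Qed.

Lemma truth_above M a A b : libra_semantics M ->
  (forall d, ole a d -> holds M d A) -> olt a b -> holds M b (Tr A).
Proof.
  intros hM H Hb n; apply (sem_truth _ hM _ _ _ (olt_pos _ _ Hb)).
  exists a; split; [assumption|]; intros d Hd _; exact (H d Hd n).
Qed.

(** The stage [a] belongs to every nonempty final segment of the stages below [osucc a]. *)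
Lemma truth_osucc M a n A : libra_semantics M -> M (osucc a) n (Tr A) -> M a n A.
Proof.
  intros hM H; apply (sem_truth _ hM _ _ _ (olt_pos _ _ (olt_osucc a))) in H.
  destruct H as [c [[_ Hc] H]]; exact (H a Hc (olt_osucc a)).
Qed.

Lemma settled_truth M A : libra_semantics M -> settled M A -> settled M (Tr A).
Proof.
  intros hM [a H]; exists (osucc a); intros d Hd.
  apply (truth_above _ _ _ _ hM H), osucc_ole, Hd.
Qed.

Lemma settled_possible M A :
  libra_semantics M -> settled M A -> settled M (Neg (Tr (Neg A))).
Proof.
  intros hM [a H]; exists (osucc a); intros d Hd n.
  apply osucc_ole in Hd.
  rewrite (full_neg _ _ (sem_full _ hM d n)); intros Ht.
  apply (sem_truth _ hM _ _ _ (olt_pos _ _ Hd)) in Ht; destruct Ht as [c [Hc Ht]].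
  (* The later of [a] and [c] lies below [d], and both [A] and its negation would hold there. *)
  destruct (ole_or_olt c a) as [Hca|Hac].
  - specialize (Ht a Hca Hd); rewrite (full_neg _ _ (sem_full _ hM a n)) in Ht.
    exact (Ht (H a (ole_refl a) n)).
  - specialize (Ht c (ole_refl c) Hc); rewrite (full_neg _ _ (sem_full _ hM c n)) in Ht.
    exact (Ht (H c (olt_ole _ _ Hac) n)).
Qed.

Lemma IN_settled M A : libra_semantics M -> (IN M A <-> settled M A).
Proof.
  intros hM; split; [intros [a H] | intros H; exact (settled_truth _ _ hM H)].
  exists a; intros d Hd n; apply (truth_osucc _ _ _ _ hM), H.
  exact (ole_trans _ _ _ Hd (olt_ole _ _ (olt_osucc d))).
Qed.

Lemma settled_at_stabilizer M w A : libra_semantics M ->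
  stabilizes M w A -> settled M A -> holds M w A.
Proof.
  intros hM [Hw _] HA n; apply (IN_settled _ _ hM) in HA.
  apply (truth_osucc _ _ _ _ hM), (Hw HA), olt_ole, olt_osucc.
Qed.

(** * Existence of ϖ *)

(** If each index had its own threshold from which [A] holds, the supremum of these countably many
    thresholds would settle [A]. *)
Lemma unsettled_index M A : ~ settled M A ->
  exists n, forall a, exists d, ole a d /\ ~ M d n A.
Proof.
  intros HA; apply NNPP; intros Hn; apply HA.
  assert (H : forall n, exists a, forall d, ole a d -> M d n A).
  { intros n; apply NNPP; intros H; apply Hn; exists n; intros a.
    apply NNPP; intros Ha; apply H; exists a; intros d Hd.
    apply NNPP; intros Hd'; apply Ha; eauto. }
  destruct (choice_fun _ H) as [f Hf]; exists (osup nat f); intros d Hd n.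
  apply Hf, (ole_trans _ _ _ (olt_ole _ _ (olt_osup _ f n)) Hd).
Qed.

Lemma stabilizer_exists M : libra_semantics M -> exists a, forall A, stabilizes M a A.
Proof.
  intros hM.
  (* Thresholds for settled formulas; [ozero] is a dummy value for the others. *)
  assert (HT : forall A, exists a, settled M A -> forall d, ole a d -> holds M d A).
  { intros A; destruct (classic (settled M A)) as [[a H]|H];
      [exists a; auto | exists ozero; tauto]. }
  destruct (choice_fun _ HT) as [T T_spec].
  assert (HN : forall A, exists n, ~ settled M A ->
    forall a, exists d, ole a d /\ ~ M d n A).
  { intros A; destruct (classic (settled M A)) as [H|H]; [exists 0; tauto|].
    destruct (unsettled_index _ _ H) as [n Hn]; eauto. }
  destruct (choice_fun _ HN) as [N N_spec].
  (* For unsettled [A], [D (A, a)] will be a stage at or above [a] where [A] fails at its fixed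
     index [N A]. *)
  assert (HD : forall p : formula * ord, exists d,
    ~ settled M (fst p) -> ole (snd p) d /\ ~ M d (N (fst p)) (fst p)).
  { intros [A a]; simpl; destruct (classic (settled M A)) as [H|H];
      [exists a; tauto|].
    destruct (N_spec A H a) as [d Hd]; eauto. }
  destruct (choice_fun _ HD) as [D D_spec].
  (* Stage 0 exceeds all thresholds; each next stage exceeds, for every unsettled formula, a failure
     at or past the previous stage. *)
  set (stage := fix stage k := match k with
    | 0 => osup formula T
    | S k => osup formula (fun A => D (A, stage k))
    end).
  exists (osup nat stage); intros A; split.
  - rewrite (IN_settled _ _ hM); intros HA b Hb.
    apply (truth_above _ _ _ _ hM (T_spec A HA)).
    refine (olt_ole_trans _ _ _ _ Hb).
    refine (ole_olt_trans _ _ _ _ (olt_osup _ stage 0)).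
    exact (olt_ole _ _ (olt_osup _ T A)).
  - intros Ht; apply (IN_settled _ _ hM), NNPP; intros HA.
    specialize (Ht (N A)).
    apply (sem_truth _ hM _ _ _ (olt_pos _ _ (olt_osup _ stage 0))) in Ht.
    destruct Ht as [c [[k Hk] Ht]].
    (* The witness [c] lies at or below [stage k], and the failure of [A] found from there still
       comes before the limit. *)
    destruct (D_spec (A, stage k) HA) as [D1 D2]; apply D2, Ht.
    + exact (ole_trans _ _ _ Hk D1).
    + refine (ole_olt_trans _ _ _ _ (olt_osup _ stage (S k))).
      exact (olt_ole _ _ (olt_osup _ (fun A => D (A, stage k)) A)).
Qed.

Lemma varpi_exists M : libra_semantics M -> exists w, is_varpi M w.
Proof.
  intros hM; destruct (stabilizer_exists _ hM) as [a Ha].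
  apply (ord_least (stabilizes_all M) a); intros A _; apply Ha.
Qed.

(** * Theses of £ *)

Lemma settled_thesis M A :
  libra_semantics M -> sentence A -> settled M A -> thesis M A.
Proof.
  intros hM sA HA; destruct (varpi_exists _ hM) as [w Hw].
  exists w; split; [assumption|].
  apply (settled_at_stabilizer _ _ _ hM).
  - apply (proj1 Hw); unfold sentence in *; simpl; tauto.
  - exact (settled_possible _ _ hM HA).
Qed.

Definition verum : formula := Imp (In Tset Tset) (In Tset Tset).

Lemma verum_provable : provable verum.
Proof.
  apply prov_taut; intros v Hv; unfold verum, Imp, Or, Neg; rewrite !Hv.
  now destruct (v _).
Qed.

Lemma truth_verum_unprovable : ~ provable (Tr verum).
(* With all atoms false, membership of [Tr verum] computes to [False], so soundness has the required
   type by conversion. *)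
Proof. exact (provable_full _ _ (eval_full (fun _ _ => False))). Qed.

Theorem theorem12p3p23 (M : family) (hM : libra_semantics M) :
  classic_theory (thesis M).
Proof.
  split; [split|].
  - intros A sA HA; apply (settled_thesis _ _ hM sA), provable_settled; assumption.
  - assert (sV : sentence (Tr verum)) by (unfold sentence; simpl; tauto).
    exists (Tr verum); split; [exact sV | split; [|exact truth_verum_unprovable]].
    apply (settled_thesis _ _ hM sV), (settled_truth _ _ hM).
    exact (provable_settled _ _ hM verum_provable).
  (* Any index serves: [Tr (Neg A)] is settled, hence holds at [w] for every index. *)
  - intros A sA [[w [[Hw _] HA]] HN]; specialize (HA 0).
    rewrite (full_neg _ _ (sem_full _ hM w 0)) in HA; apply HA.
    apply (settled_at_stabilizer _ _ _ hM).
    + apply Hw; unfold sentence in *; simpl; tauto.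
    + exact (settled_truth _ _ hM (provable_settled _ _ hM HN)).
Qed.
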